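(* Let $\mathcal{X}=\{X(n),\,n=0,1,\dots\}$ be a discrete-time birth-death process (random walk) on $\mathcal{N}=\{0,1,2,\dots\}$ with one-step transition probabilities $P_{j,j+1}=p_j$, $P_{j,j}=r_j$, $P_{j+1,j}=q_{j+1}$ (all other one-step transitions having probability $0$), where $p_j>0$, $q_{j+1}>0$, $r_j\ge 0$ and $p_j+q_j+r_j=1$ for all $j\ge 0$, with $q_0:=0$. Let $\pi_0:=1$ and $\pi_n:=\frac{p_0p_1\cdots p_{n-1}}{q_1q_2\cdots q_n}$ for $n\ge 1$. If \[\sum_{j\ge 0}\frac{1}{p_j\pi_j}\sum_{k=0}^j r_k\pi_k=\infty,\] then $\mathcal{X}$ possesses the strong ratio limit property, i.e. the limits \[\lim_{n\to\infty}\frac{P_{ij}(n)}{P_{kl}(n)},\qquad i,j,k,l\in\mathcal{N},\] all exist, where $P_{ij}(n)=\Pr\{X(n)=j\mid X(0)=i\}$ denotes the $n$-step transition probability.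
   Context: All notation is defined in the claim. *)

(* Defs.v *)
From Stdlib Require Import Reals Lra Arith.
Open Scope R_scope.

Definition bd_step (p q r : nat -> R) (i j : nat) : R :=
  if Nat.eqb j (S i) then p i
  else if Nat.eqb j i then r i
  else if Nat.eqb (S j) i then q i
  else 0.

(* n-step transition probabilities P_{ij}(n) = (P^n)_{ij}.  Since row i of the
   one-step matrix is supported on {i-1, i, i+1}, the matrix product
   P^{n+1}_{ij} = sum_k P_{ik} P^n_{kj} is the finite sum below
   (for i = 0 the state i-1 does not exist; its coefficient bd_step 0 0 ... is
   not used: we simply skip it). *)
Fixpoint bd_nstep (p q r : nat -> R) (n i j : nat) : R :=
  match n with
  | O => if Nat.eqb i j then 1 else 0
  | S m =>
      (match i with
       | O => 0
       | S i' => bd_step p q r i i' * bd_nstep p q r m i' j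
       end)
      + bd_step p q r i i * bd_nstep p q r m i j
      + bd_step p q r i (S i) * bd_nstep p q r m (S i) j
  end.

Fixpoint bd_pi (p q : nat -> R) (n : nat) : R :=
  match n with
  | O => 1
  | S m => bd_pi p q m * p m / q (S m)
  end.

(* Main.v *)
(* Write a(n) = P_00(n) and let Q_i(x) be the orthogonal polynomials of the walk,
   x Q_i = q_i Q_{i-1} + r_i Q_i + p_i Q_{i+1}, Q_0 = 1; no spectral measure is needed.
   Reversibility makes (a(m+n)) a Gram matrix, so a(2n) is log-convex,
   a(2n+2)/a(2n) increases to some rho^2 <= 1, and P^2 <= rho^2 as a quadratic form on
   the span of the P^k delta_0.  Hence, with d_n = a(2n+1)/a(2n),
     P_i0(2n)/a(2n) ~ (1 + d_n/rho)/2 Q_i(rho) + (1 - d_n/rho)/2 Q_i(-rho),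
     P_i0(2n+1)/a(2n) ~ rho ((1 + d_n/rho)/2 Q_i(rho) - (1 - d_n/rho)/2 Q_i(-rho)).
   Both left-hand sides are nonnegative, so Q_i(rho) > 0 and
   |rho - d_n| |Q_i(-rho)| <= (rho + d_n) Q_i(rho) + o(1).  A Casoratian computation
   (using that Q_i(rho) decreases in i because rho <= 1) bounds |Q_i(-rho)|/Q_i(rho) from
   below by the partial sums of the divergent series, which forces d_n -> rho.  Then
   a(n+1)/a(n) -> rho, and the recurrences give P_ij(n)/a(n) -> pi_j Q_i(rho) Q_j(rho). *)

Require Import Defs.
From Stdlib Require Import Reals Lra Lia Psatz.
From Coquelicot Require Import Coquelicot.
Open Scope R_scope.

(** * Quadratic forms and log-convex sequences *)

Lemma discriminant_le (A B C : R) :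
  (forall x, 0 <= A + 2 * x * B + x ^ 2 * C) -> B ^ 2 <= A * C.
Proof.
  intros H.
  assert (HA := H 0).
  destruct (Req_dec C 0) as [-> | HC].
  - destruct (Req_dec B 0) as [-> | HB]; [nra |].
    specialize (H (- (A + 1) / (2 * B))).
    replace (A + 2 * (- (A + 1) / (2 * B)) * B + (- (A + 1) / (2 * B)) ^ 2 * 0)
      with (-1) in H by (field; exact HB).
    lra.
  - assert (HC0 : 0 < C).
    { assert (H1 := H 1). assert (H2 := H (-1)).
      destruct (Rlt_le_dec 0 C) as [h | h]; [exact h |].
      assert (hC : C < 0) by lra.
      (* At this [x >= 1] the term [x ^ 2 * C] outweighs [A + 2 * x * B], so the form is
         negative. *)
      set (x := 1 + (A + 1 + 2 * Rabs B) / - C).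
      assert (Hx1 : x * - C = - C + (A + 1 + 2 * Rabs B)) by (unfold x; field; lra).
      assert (HB := Rabs_pos B). assert (HB' := Rle_abs B).
      assert (Hx : 1 <= x).
      { apply Rmult_le_reg_r with (- C); lra. }
      specialize (H x). nra. }
    specialize (H (- B / C)).
    replace (A + 2 * (- B / C) * B + (- B / C) ^ 2 * C)
      with ((A * C - B ^ 2) / C) in H by (field; exact HC).
    apply Rmult_le_compat_r with (r := C) in H; [| lra].
    replace ((A * C - B ^ 2) / C * C) with (A * C - B ^ 2) in H by (field; exact HC).
    lra.
Qed.

(** Ratios of a log-convex sequence increase, so a ratio [t > s] at [m] would persist and give
    growth of order [t ^ n], against the bound [C * s ^ n]. *)
Lemma logconvex_ratio_le (b : nat -> R) (s C : R) (m : nat) :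
  0 < s -> (forall n, 0 <= b n) ->
  (forall n, b (S n) ^ 2 <= b n * b (S (S n))) ->
  (forall n, b (n + m)%nat <= C * s ^ n) -> b (S m) <= s * b m.
Proof.
  intros Hs Hb Hlc HC.
  destruct (Rle_lt_dec (b (S m)) (s * b m)) as [h | h]; [exact h | exfalso].
  assert (Hb0 : 0 < b m).
  { destruct (Hb m) as [| e]; [assumption |].
    assert (h1 := Hlc m). rewrite <- e in h, h1. nra. }
  set (t := b (S m) / b m).
  assert (Ht : b (S m) = t * b m) by (unfold t; field; lra).
  assert (Hst : s < t) by (apply Rmult_lt_reg_r with (b m); lra).
  assert (Hgrow : forall n, 0 < b (n + m)%nat /\ t * b (n + m)%nat <= b (S (n + m))).
  { induction n as [| n [IH1 IH2]]; [simpl; split; lra |].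
    assert (0 < b (S (n + m))) by nra.
    change (S n + m)%nat with (S (n + m)). split; [assumption |].
    assert (h1 := Hlc (n + m)%nat).
    apply Rmult_le_reg_l with (b (n + m)%nat); [assumption |]. nra. }
  assert (Hpow : forall n, b m * t ^ n <= b (n + m)%nat).
  { induction n as [| n IH]; [simpl; lra |].
    destruct (Hgrow n) as [_ h1]. simpl. simpl in h1. nra. }
  destruct (Pow_x_infinity (t / s)) with (b := (Rabs C + 1) / b m) as [N HN].
  { rewrite Rabs_pos_eq; [apply Rmult_lt_reg_r with s; [lra |] | apply Rle_div_r; lra].
    unfold Rdiv. rewrite Rmult_assoc, Rinv_l; lra. }
  specialize (HN N (le_n N)).
  assert (Hsn := pow_lt s N Hs).
  assert (Htn : 0 < t ^ N) by (apply pow_lt; lra).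
  unfold Rdiv in HN at 1. rewrite Rpow_mult_distr, pow_inv in HN.
  rewrite Rabs_pos_eq in HN;
    [| apply Rmult_le_pos; [lra | left; apply Rinv_0_lt_compat; lra]].
  assert (h1 := Hpow N). assert (h2 := HC N).
  assert (h3 : b m * (t ^ N * / s ^ N) <= C).
  { apply Rmult_le_reg_r with (s ^ N); [assumption |].
    replace (b m * (t ^ N * / s ^ N) * s ^ N) with (b m * t ^ N)
      by (field; lra). lra. }
  assert (h4 : Rabs C + 1 <= b m * (t ^ N * / s ^ N)).
  { apply Rge_le in HN. apply Rmult_le_compat_l with (r := b m) in HN; [| lra].
    replace (b m * ((Rabs C + 1) / b m)) with (Rabs C + 1) in HN
      by (field; lra). lra. }
  assert (h5 := Rle_abs C). lra.
Qed.

Ltac lim_arith :=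
  repeat match goal with
  | |- is_lim_seq (fun _ => ?c) _ => apply is_lim_seq_const
  | |- is_lim_seq (fun n => @?u n + @?v n) _ => apply is_lim_seq_plus'
  | |- is_lim_seq (fun n => @?u n - @?v n) _ => apply is_lim_seq_minus'
  | |- is_lim_seq (fun n => @?u n * @?v n) _ => apply is_lim_seq_mult'
  | |- is_lim_seq _ _ => assumption
  end.

(** * Weighted inner product and reversibility *)

Section BirthDeath.

Context (p q r : nat -> R)
  (hp : forall j, 0 < p j)
  (hq : forall j, 0 < q (S j))
  (hr : forall j, 0 <= r j)
  (hq0 : q O = 0)
  (hsum : forall j, p j + q j + r j = 1).

Local Notation P := (bd_nstep p q r).
Local Notation pi := (bd_pi p q).

(** Truncated inner product of l^2(pi). The columns of [P n] have finite support, so a large [K]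
    loses nothing. *)
Definition wip (K : nat) (f g : nat -> R) : R :=
  sum_f_R0 (fun j => pi j * f j * g j) K.

(* With [q 0 = 0] the junk value [pred 0 = 0] is harmless, so the boundary row needs no special case. *)
Definition bd_recurrence (f' f : nat -> R) : Prop :=
  forall i, f' i = q i * f (pred i) + r i * f i + p i * f (S i).

Lemma q_nonneg j : 0 <= q j.
Proof. destruct j as [| j]; [lra | left; apply hq]. Qed.

Lemma pi_pos j : 0 < pi j.
Proof.
  induction j as [| j IH]; simpl; [lra |].
  apply Rdiv_lt_0_compat; [| apply hq].
  apply Rmult_lt_0_compat; [assumption | apply hp].
Qed.

Lemma pi_balance j : pi (S j) * q (S j) = pi j * p j.
Proof. simpl. field. specialize (hq j). lra. Qed.

Lemma nstep_recurrence n j : bd_recurrence (fun i => P (S n) i j) (fun i => P n i j).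
Proof.
  intros i. cbn [bd_nstep]. unfold bd_step.
  rewrite !Nat.eqb_refl, (proj2 (Nat.eqb_neq i (S i))) by lia.
  destruct i as [| i]; cbn [pred]; [rewrite hq0, Rmult_0_l; reflexivity |].
  rewrite Nat.eqb_refl, (proj2 (Nat.eqb_neq i (S (S i)))),
    (proj2 (Nat.eqb_neq i (S i))) by lia.
  ring.
Qed.

Lemma nstep_bounds n : forall i j, 0 <= P n i j <= 1.
Proof.
  induction n as [| n IH]; intros i j.
  - simpl. destruct (i =? j)%nat; lra.
  - rewrite (nstep_recurrence n j i).
    assert (h1 := IH (pred i) j). assert (h2 := IH i j). assert (h3 := IH (S i) j).
    assert (h4 := q_nonneg i). assert (h5 := hp i). assert (h6 := hr i).
    assert (h7 := hsum i). nra.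
Qed.

Lemma nstep_support n : forall i j, (j + n < i)%nat -> P n i j = 0.
Proof.
  induction n as [| n IH]; intros i j hij.
  - simpl. destruct (Nat.eqb_spec i j); [lia | reflexivity].
  - rewrite (nstep_recurrence n j i). cbv beta. rewrite (IH (pred i)), (IH i), (IH (S i)) by lia. lra.
Qed.

Lemma green_identity K f' f g' g :
  bd_recurrence f' f -> bd_recurrence g' g ->
  wip K f' g - wip K f g' = p K * pi K * (f (S K) * g K - f K * g (S K)).
Proof.
  intros Hf Hg. unfold wip.
  induction K as [| K IH].
  - simpl sum_f_R0. rewrite (Hf 0%nat), (Hg 0%nat), hq0. simpl. ring.
  - rewrite !tech5, (Hf (S K)), (Hg (S K)). simpl pred.
    assert (e := pi_balance K).
    transitivity (p K * pi K * (f (S K) * g K - f K * g (S K))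
      + pi (S K) * q (S K) * (f K * g (S K) - f (S K) * g K)
      + p (S K) * pi (S K) * (f (S (S K)) * g (S K) - f (S K) * g (S (S K)))).
    + rewrite <- IH. ring.
    + rewrite e. ring.
Qed.

Lemma wip_delta_l K a g :
  (a <= K)%nat -> wip K (fun i => P 0 i a) g = pi a * g a.
Proof.
  intros h. unfold wip. simpl.
  induction K as [| K IH].
  - replace a with 0%nat by lia. simpl. ring.
  - rewrite tech5. destruct (Nat.eqb_spec (S K) a) as [<- | ne].
    + rewrite sum_eq_R0; [ring |].
      intros k hk. destruct (Nat.eqb_spec k (S K)); [lia | ring].
    + rewrite IH by lia. ring.
Qed.

Lemma wip_sym K f g : wip K f g = wip K g f.
Proof. apply sum_eq. intros. ring. Qed.

(** Green's identity moves one step at a time from the left factor to the right; the boundary flux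
    vanishes because [K] lies beyond the support. *)
Lemma wip_nstep a b K : forall m n, (a + b + m + n < K)%nat ->
  wip K (fun i => P m i a) (fun i => P n i b) = pi a * P (m + n) a b.
Proof.
  induction m as [| m IH]; intros n h.
  - exact (wip_delta_l K a (fun i => P n i b) ltac:(lia)).
  - assert (e := green_identity K _ _ _ _ (nstep_recurrence m a) (nstep_recurrence n b)).
    cbv beta in e.
    rewrite (nstep_support m (S K)), (nstep_support m K) in e by lia.
    rewrite IH in e by lia.
    rewrite Nat.add_succ_comm. lra.
Qed.

Lemma nstep_reversible n a b : pi a * P n a b = pi b * P n b a.
Proof.
  rewrite <- (wip_delta_l (S (a + b + n)) a (fun i => P n i b)) by lia.
  rewrite wip_sym, wip_nstep by lia.
  now rewrite Nat.add_0_r.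
Qed.

Lemma wip_cauchy_schwarz K f g : wip K f g ^ 2 <= wip K f f * wip K g g.
Proof.
  apply discriminant_le. intros x.
  replace (wip K f f + 2 * x * wip K f g + x ^ 2 * wip K g g)
    with (wip K (fun i => f i + x * g i) (fun i => f i + x * g i)).
  - apply cond_pos_sum. intros j. rewrite Rmult_assoc.
    apply Rmult_le_pos; [left; apply pi_pos | apply Rle_0_sqr].
  - unfold wip. rewrite !scal_sum, <- !sum_plus.
    apply sum_eq. intros. ring.
Qed.

(** * Return probabilities as a Gram matrix *)

Local Notation a n := (P n 0%nat 0%nat).

Lemma wip_return K m n : (m + n < K)%nat ->
  wip K (fun i => P m i 0%nat) (fun i => P n i 0%nat) = a (m + n).
Proof. intros h. rewrite wip_nstep by lia. simpl. ring. Qed.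

(** The squared l^2(pi) norm of [(1 + x P) P^n delta_0]. *)
Definition quad (x : R) (n : nat) : R :=
  a (2 * n) + 2 * x * a (S (2 * n)) + x ^ 2 * a (2 * S n).

Lemma wip_quad x m n K : (m + n + 2 < K)%nat ->
  wip K (fun i => P m i 0%nat + x * P (S m) i 0%nat)
        (fun i => P n i 0%nat + x * P (S n) i 0%nat) =
  a (m + n) + 2 * x * a (S (m + n)) + x ^ 2 * a (S (S (m + n))).
Proof.
  intros h.
  assert (e0 := wip_return K m n ltac:(lia)).
  assert (e1 := wip_return K (S m) n ltac:(lia)).
  assert (e2 := wip_return K m (S n) ltac:(lia)).
  assert (e3 := wip_return K (S m) (S n) ltac:(lia)).
  replace (S m + n)%nat with (S (m + n)) in e1 by lia.
  replace (m + S n)%nat with (S (m + n)) in e2 by lia.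
  replace (S m + S n)%nat with (S (S (m + n))) in e3 by lia.
  transitivity (a (m + n) + x * a (S (m + n)) + x * a (S (m + n))
     + x ^ 2 * a (S (S (m + n)))); [| ring].
  rewrite <- e3. rewrite <- e1 at 1. rewrite <- e2, <- e0.
  unfold wip. rewrite !scal_sum, <- !sum_plus.
  apply sum_eq. intros. ring.
Qed.

Lemma quad_wip x m n N K : (m + n = 2 * N)%nat -> (2 * N + 2 < K)%nat ->
  wip K (fun i => P m i 0%nat + x * P (S m) i 0%nat)
        (fun i => P n i 0%nat + x * P (S n) i 0%nat) = quad x N.
Proof.
  intros e h. rewrite wip_quad, e by lia. unfold quad.
  now replace (2 * S N)%nat with (S (S (2 * N))) by lia.
Qed.

Lemma quad_nonneg x n : 0 <= quad x n.
Proof.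
  rewrite <- (quad_wip x n n n (2 * n + 3)) by lia.
  apply cond_pos_sum. intros j. rewrite Rmult_assoc.
  apply Rmult_le_pos; [left; apply pi_pos | apply Rle_0_sqr].
Qed.

(** Cauchy-Schwarz for the vectors with exponents [n] and [n + 2]: their pairing depends only on the
    sum of the exponents, hence equals [quad x (S n)]. *)
Lemma quad_logconvex x n : quad x (S n) ^ 2 <= quad x n * quad x (S (S n)).
Proof.
  rewrite <- (quad_wip x n n n (2 * n + 7)) by lia.
  rewrite <- (quad_wip x n (S (S n)) (S n) (2 * n + 7)) by lia.
  rewrite <- (quad_wip x (S (S n)) (S (S n)) (S (S n)) (2 * n + 7)) by lia.
  apply wip_cauchy_schwarz.
Qed.

(** Here [a 2 >= p 0 * q 1 > 0], and by log-convexity a later zero would force its predecessor to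
    vanish. *)
Lemma return_even_pos n : 0 < a (2 * n).
Proof.
  cut (0 < a (2 * n) /\ 0 < a (2 * S n)); [tauto |].
  induction n as [| n [IH1 IH2]].
  - split; [simpl; lra |]. change (2 * 1)%nat with 2%nat.
    rewrite (nstep_recurrence 1 0 0%nat). cbv beta.
    assert (h : P 1 1%nat 0%nat = q 1%nat).
    { rewrite (nstep_recurrence 0 0 1%nat).
      change (q 1%nat * 1 + r 1%nat * 0 + p 1%nat * 0 = q 1%nat). ring. }
    rewrite h, hq0. assert (h1 := nstep_bounds 1 0 0).
    assert (h2 := Rmult_lt_0_compat _ _ (hp 0) (hq 0)).
    assert (h3 := Rmult_le_pos _ _ (hr 0) (proj1 h1)). lra.
  - split; [assumption |].
    assert (h := quad_logconvex 0 n). unfold quad in h.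
    rewrite pow_i, !Rmult_0_r, !Rmult_0_l, !Rplus_0_r in h by lia.
    assert (0 < a (2 * S n) ^ 2) by (apply pow_lt; assumption).
    destruct (nstep_bounds (2 * S (S n)) 0 0) as [[|e] _]; [assumption |].
    rewrite <- e in h. lra.
Qed.

(** * Even and odd return ratios *)

Definition even_ratio (n : nat) : R := a (2 * S n) / a (2 * n).
Definition odd_ratio (n : nat) : R := a (S (2 * n)) / a (2 * n).

Lemma even_ratio_pos n : 0 < even_ratio n.
Proof. apply Rdiv_lt_0_compat; apply return_even_pos. Qed.

Lemma even_ratio_eq n : a (2 * S n) = even_ratio n * a (2 * n).
Proof. unfold even_ratio. field. assert (h := return_even_pos n). lra. Qed.

Lemma odd_ratio_eq n : a (S (2 * n)) = odd_ratio n * a (2 * n).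
Proof. unfold odd_ratio. field. assert (h := return_even_pos n). lra. Qed.

Lemma quad_0 n : quad 0 n = a (2 * n).
Proof. unfold quad. ring. Qed.

Lemma even_ratio_le_1 n : even_ratio n <= 1.
Proof.
  assert (h0 := return_even_pos n).
  apply Rmult_le_reg_r with (a (2 * n)); [assumption |].
  rewrite <- even_ratio_eq.
  apply (logconvex_ratio_le (fun k => a (2 * k)) 1 1 n); [lra | | |].
  - intros k. left. apply return_even_pos.
  - intros k. rewrite <- !quad_0. apply quad_logconvex.
  - intros k. rewrite pow1, Rmult_1_r. apply nstep_bounds.
Qed.

Lemma even_ratio_incr n : even_ratio n <= even_ratio (S n).
Proof.
  assert (h0 := return_even_pos n). assert (h1 := return_even_pos (S n)).
  assert (h := quad_logconvex 0 n). rewrite !quad_0, (even_ratio_eq (S n)) in h.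
  apply Rmult_le_reg_r with (a (2 * n)); [assumption |].
  rewrite <- even_ratio_eq.
  apply Rmult_le_reg_r with (a (2 * S n)); [assumption |]. lra.
Qed.

(** The upper bound is [quad (-1) n >= 0] together with [even_ratio n <= 1]. *)
Lemma odd_ratio_bounds n : 0 <= odd_ratio n <= 1.
Proof.
  assert (h0 := return_even_pos n).
  split; [apply Rle_div_r; [lra |]; rewrite Rmult_0_l; apply nstep_bounds |].
  apply Rmult_le_reg_r with (a (2 * n)); [assumption |].
  rewrite <- odd_ratio_eq.
  assert (h1 := quad_nonneg (-1) n). unfold quad in h1.
  rewrite even_ratio_eq in h1. assert (h2 := even_ratio_le_1 n). nra.
Qed.

Lemma even_ratio_lim :
  exists rho, 0 < rho <= 1 /\ is_lim_seq even_ratio (rho ^ 2) /\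
    forall n, even_ratio n <= rho ^ 2.
Proof.
  destruct (ex_finite_lim_seq_incr even_ratio 1 even_ratio_incr even_ratio_le_1)
    as [s Hs].
  assert (Hle := is_lim_seq_incr_compare _ _ Hs even_ratio_incr).
  assert (H0 := even_ratio_pos 0). assert (H1 := Hle 0%nat).
  assert (Hs1 : s <= 1).
  { apply (is_lim_seq_le _ (fun _ => 1) s 1 even_ratio_le_1 Hs).
    apply is_lim_seq_const. }
  assert (e : sqrt s ^ 2 = s) by (apply pow2_sqrt; lra).
  exists (sqrt s). rewrite e. repeat split; [| | assumption | assumption].
  - apply sqrt_lt_R0. lra.
  - rewrite <- sqrt_1. apply sqrt_le_1_alt. assumption.
Qed.

Lemma is_lim_seq_mult_bounded (u v : nat -> R) M :
  is_lim_seq u 0 -> (forall n, Rabs (v n) <= M) ->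
  is_lim_seq (fun n => u n * v n) 0.
Proof.
  intros Hu Hv.
  apply is_lim_seq_abs_0.
  apply (is_lim_seq_le_le (fun _ => 0) _ (fun n => Rabs (u n) * M)).
  - intros n. rewrite Rabs_mult. split.
    + apply Rmult_le_pos; apply Rabs_pos.
    + apply Rmult_le_compat_l; [apply Rabs_pos | apply Hv].
  - apply is_lim_seq_const.
  - replace (Finite 0) with (Finite (0 * M)) by (f_equal; ring).
    apply is_lim_seq_mult'; [| apply is_lim_seq_const].
    now apply is_lim_seq_abs_0 in Hu.
Qed.

(** * Orthogonal polynomials of the walk *)

Fixpoint bd_poly (x : R) (i : nat) : R :=
  match i with
  | O => 1
  | S m => ((x - r m) * bd_poly x m
            - match m with O => 0 | S k => q m * bd_poly x k end) / p m
  end.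

Lemma bd_poly_recurrence x : bd_recurrence (fun i => x * bd_poly x i) (bd_poly x).
Proof.
  intros i. assert (h := hp i).
  destruct i as [| i]; cbn [pred].
  - rewrite hq0. simpl. field. lra.
  - change (bd_poly x (S (S i)))
      with (((x - r (S i)) * bd_poly x (S i) - q (S i) * bd_poly x i) / p (S i)).
    field. lra.
Qed.

(** * Slow variation of the odd ratios *)

Section Ratio.

Context (rho : R) (rho_pos : 0 < rho) (rho_le_1 : rho <= 1)
  (Hlim : is_lim_seq even_ratio (rho ^ 2))
  (Hle : forall n, even_ratio n <= rho ^ 2).

Lemma return_even_growth n k : a (2 * (n + k)) <= a (2 * n) * (rho ^ 2) ^ k.
Proof.
  induction k as [| k IH]; [rewrite Nat.add_0_r; simpl; lra |].
  rewrite Nat.add_succ_r, even_ratio_eq.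
  change ((rho ^ 2) ^ S k) with (rho ^ 2 * (rho ^ 2) ^ k).
  assert (h1 := return_even_pos (n + k)). assert (h2 := Hle (n + k)).
  assert (h3 := pow_lt rho 2 rho_pos). nra.
Qed.

(* The form inequality [P^2 <= rho^2], evaluated at [(1 + x P) P^n delta_0]. *)
Lemma quad_decay x n : x ^ 2 = 1 -> quad x (S n) <= rho ^ 2 * quad x n.
Proof.
  intros Hx.
  (* The factor 4 is 1 + 2 + 1: for [x = 1] or [x = -1], each return probability in [quad x (n + k)]
     is at most [a (2 * (n + k))]. *)
  apply (logconvex_ratio_le (quad x) (rho ^ 2) (4 * a (2 * n))).
  - now apply pow_lt.
  - apply quad_nonneg.
  - apply quad_logconvex.
  - intros k. rewrite Nat.add_comm. assert (h := return_even_growth n k).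
    assert (h1 := odd_ratio_bounds (n + k)). assert (h2 := even_ratio_le_1 (n + k)).
    assert (h3 := return_even_pos (n + k)).
    unfold quad. rewrite Hx, even_ratio_eq, odd_ratio_eq.
    assert (h4 : x <= 1) by nra. assert (h5 : -1 <= x) by nra.
    assert (h6 : x * (odd_ratio (n + k) * a (2 * (n + k))) <= a (2 * (n + k))).
    { assert (odd_ratio (n + k) * a (2 * (n + k)) <= a (2 * (n + k))) by nra.
      assert (0 <= odd_ratio (n + k) * a (2 * (n + k))) by nra. nra. }
    nra.
Qed.

(** The two signs of the absolute value are [quad_decay] at [x = 1] and [x = -1], divided by
    [a (2 * n)]. *)
Lemma odd_ratio_step n :
  Rabs (rho ^ 2 * odd_ratio n - even_ratio n * odd_ratio (S n)) <=
  ((rho ^ 2 - even_ratio n) + even_ratio n * (rho ^ 2 - even_ratio (S n))) / 2.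
Proof.
  assert (h1 := quad_decay 1 n ltac:(ring)).
  assert (h2 := quad_decay (-1) n ltac:(ring)).
  unfold quad in h1, h2.
  rewrite (odd_ratio_eq (S n)), (even_ratio_eq (S n)), odd_ratio_eq, even_ratio_eq
    in h1, h2.
  assert (h0 := return_even_pos n).
  apply Rabs_le. split; apply Rmult_le_reg_r with (a (2 * n)); try assumption; lra.
Qed.

(** The right side of [odd_ratio_step] tends to 0, and [even_ratio n] may be replaced by its nonzero
    limit [rho ^ 2]. Convergence of [odd_ratio] itself does not follow yet. *)
Lemma odd_ratio_diff_lim : is_lim_seq (fun n => odd_ratio (S n) - odd_ratio n) 0.
Proof.
  assert (h0 := pow_lt rho 2 rho_pos).
  assert (HlimS := proj1 (is_lim_seq_incr_1 _ _) Hlim).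
  assert (Hd : is_lim_seq (fun n => rho ^ 2 - even_ratio n) 0).
  { replace (Finite 0) with (Finite (rho ^ 2 - rho ^ 2)) by (f_equal; ring).
    apply is_lim_seq_minus'; [apply is_lim_seq_const | assumption]. }
  apply is_lim_seq_ext with (u := fun n =>
    / rho ^ 2 * ((rho ^ 2 - even_ratio n) * odd_ratio (S n)
      - (rho ^ 2 * odd_ratio n - even_ratio n * odd_ratio (S n)))).
  { intros n. field. lra. }
  replace (Finite 0) with (Finite (/ rho ^ 2 * (0 - 0))) by (f_equal; ring).
  apply is_lim_seq_mult'; [apply is_lim_seq_const |].
  apply is_lim_seq_minus'.
  - apply is_lim_seq_mult_bounded with 1; [assumption |].
    intros n. rewrite Rabs_pos_eq; apply odd_ratio_bounds.
  - apply is_lim_seq_abs_0.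
    apply (is_lim_seq_le_le (fun _ => 0) _ _ 0 (fun n => conj (Rabs_pos _) (odd_ratio_step n))).
    + apply is_lim_seq_const.
    + replace (Finite 0) with (Finite ((0 + rho ^ 2 * (rho ^ 2 - rho ^ 2)) * / 2))
        by (f_equal; field).
      apply is_lim_seq_mult'; [| apply is_lim_seq_const].
      apply is_lim_seq_plus'; [assumption |].
      apply is_lim_seq_mult'; [assumption |].
      apply is_lim_seq_minus'; [apply is_lim_seq_const | assumption].
Qed.

(** * Asymptotics of column 0 at even and odd times *)

Local Notation Q := (bd_poly rho).
Local Notation Q' := (bd_poly (- rho)).

(** [poly_even] and [poly_odd] are the even and odd parts of [bd_poly x i] in [x], taken at [rho],
    the odd part divided by [rho]. Multiplication by [x] exchanges them, as one step exchanges even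
    and odd times. *)
Definition poly_even (i : nat) : R := (Q i + Q' i) / 2.
Definition poly_odd (i : nat) : R := (Q i - Q' i) / (2 * rho).

Lemma poly_even_recurrence : bd_recurrence (fun i => rho ^ 2 * poly_odd i) poly_even.
Proof.
  intros i. assert (h1 := bd_poly_recurrence rho i).
  assert (h2 := bd_poly_recurrence (- rho) i). cbv beta in h1, h2.
  unfold poly_even, poly_odd.
  transitivity ((rho * Q i + - rho * Q' i) / 2); [field; lra |].
  rewrite h1, h2. field.
Qed.

Lemma poly_odd_recurrence : bd_recurrence poly_even poly_odd.
Proof.
  intros i. assert (h1 := bd_poly_recurrence rho i).
  assert (h2 := bd_poly_recurrence (- rho) i). cbv beta in h1, h2.
  unfold poly_even, poly_odd.
  transitivity ((rho * Q i - - rho * Q' i) / (2 * rho)); [field; lra |].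
  rewrite h1, h2. field. lra.
Qed.

(* [poly_even i + d * poly_odd i] is [(1 + d/rho)/2 * Q i + (1 - d/rho)/2 * Q' i]. *)
Definition even_error (i n : nat) : R :=
  P (2 * n) i 0%nat / a (2 * n) - (poly_even i + odd_ratio n * poly_odd i).
Definition odd_error (i n : nat) : R :=
  P (S (2 * n)) i 0%nat / a (2 * n) - (rho ^ 2 * poly_odd i + odd_ratio n * poly_even i).

Lemma even_error_recurrence i n :
  odd_error i n = q i * even_error (pred i) n + r i * even_error i n
    + p i * even_error (S i) n.
Proof.
  unfold odd_error, even_error.
  rewrite (poly_even_recurrence i), (poly_odd_recurrence i), (nstep_recurrence _ _ i).
  assert (h := return_even_pos n). field. lra.
Qed.

(** The step from time [2 * n + 1] to [2 * n + 2] also changes the normaliser and the odd ratio; the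
    bracketed correction accounts for both and tends to 0. *)
Lemma odd_error_recurrence i n :
  even_ratio n * even_error i (S n)
  + ((rho ^ 2 - even_ratio n) * - (poly_even i + odd_ratio (S n) * poly_odd i)
     + rho ^ 2 * poly_odd i * (odd_ratio (S n) - odd_ratio n)) =
  q i * odd_error (pred i) n + r i * odd_error i n + p i * odd_error (S i) n.
Proof.
  unfold odd_error, even_error.
  assert (h := return_even_pos n). assert (h' := return_even_pos (S n)).
  transitivity (P (2 * S n) i 0%nat / a (2 * n)
     - (rho ^ 2 * poly_even i + odd_ratio n * (rho ^ 2 * poly_odd i))).
  - unfold even_ratio. field. lra.
  - transitivity (P (2 * S n) i 0%nat / a (2 * n)
      - (rho ^ 2 * (q i * poly_odd (pred i) + r i * poly_odd i + p i * poly_odd (S i))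
         + odd_ratio n
           * (q i * poly_even (pred i) + r i * poly_even i + p i * poly_even (S i)))).
    { now rewrite <- (poly_even_recurrence i), <- (poly_odd_recurrence i). }
    replace (2 * S n)%nat with (S (S (2 * n))) by lia.
    rewrite (nstep_recurrence (S (2 * n)) _ i). field. lra.
Qed.

(** Both errors vanish identically at [i = 0]; since [p i > 0], the recurrences can be solved for
    row [S i] in terms of rows [pred i] and [i]. *)
Lemma errors_lim i : is_lim_seq (even_error i) 0 /\ is_lim_seq (odd_error i) 0.
Proof.
  assert (step : forall u v w z : nat -> R, forall i,
    (forall n, z n = q i * u n + r i * v n + p i * w n) ->
    is_lim_seq u 0 -> is_lim_seq v 0 -> is_lim_seq z 0 -> is_lim_seq w 0).
  { clear i. intros u v w z i e Hu Hv Hz. assert (h := hp i).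
    apply is_lim_seq_ext with (u := fun n => / p i * (z n - (q i * u n + r i * v n))).
    { intros n. rewrite e. field. lra. }
    replace (Finite 0) with (Finite (/ p i * (0 - (q i * 0 + r i * 0))))
      by (f_equal; ring).
    lim_arith. }
  set (good i := is_lim_seq (even_error i) 0 /\ is_lim_seq (odd_error i) 0).
  cut (good (pred i) /\ good i); [tauto |].
  assert (Hd : is_lim_seq (fun n => rho ^ 2 - even_ratio n) 0).
  { replace (Finite 0) with (Finite (rho ^ 2 - rho ^ 2)) by (f_equal; ring).
    apply is_lim_seq_minus'; [apply is_lim_seq_const | assumption]. }
  induction i as [| i [[IH1 IH2] [IH3 IH4]]].
  - assert (good 0%nat); [| tauto].
    split; apply is_lim_seq_ext with (u := fun _ => 0);
      try apply is_lim_seq_const; intros n; assert (h := return_even_pos n);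
      unfold even_error, odd_error, odd_ratio, poly_even, poly_odd;
      cbn [bd_poly]; field; lra.
  - split; [split; assumption |]. split.
    + exact (step _ _ _ _ i (even_error_recurrence i) IH1 IH3 IH4).
    + refine (step _ _ _ _ i (fun n => odd_error_recurrence i n) IH2 IH4 _).
      replace (Finite 0)
        with (Finite (rho ^ 2 * 0 + (0 + rho ^ 2 * poly_odd i * 0)))
        by (f_equal; ring).
      apply is_lim_seq_plus'.
      { apply is_lim_seq_mult'; [assumption |].
        now apply is_lim_seq_incr_1 in IH3. }
      apply is_lim_seq_plus'.
      * apply is_lim_seq_mult_bounded with (Rabs (poly_even i) + Rabs (poly_odd i));
          [assumption |].
        intros n. rewrite Rabs_Ropp.
        eapply Rle_trans; [apply Rabs_triang |].
        rewrite Rabs_mult. assert (h := odd_ratio_bounds (S n)).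
        rewrite (Rabs_pos_eq (odd_ratio (S n))) by lra.
        assert (h' := Rabs_pos (poly_odd i)). nra.
      * apply is_lim_seq_mult'; [apply is_lim_seq_const |].
        apply odd_ratio_diff_lim.
Qed.

(** With [u], [v] the normalised probabilities at times [2 * n] and [2 * n + 1], the sum
    [rho * u + v] isolates [Q i] and the difference isolates [Q' i]. Nonnegativity of [u] and [v]
    bounds the difference by the sum. *)
Lemma poly_even_odd_bound i n :
  Rabs (rho - odd_ratio n) * Rabs (Q' i) <=
  (rho + odd_ratio n) * Q i + 2 * (rho * Rabs (even_error i n) + Rabs (odd_error i n))
  /\ 0 <= (rho + odd_ratio n) * Q i + (rho * even_error i n + odd_error i n).
Proof.
  assert (h0 := return_even_pos n).
  set (u := P (2 * n) i 0%nat / a (2 * n)).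
  set (v := P (S (2 * n)) i 0%nat / a (2 * n)).
  assert (hu : 0 <= u).
  { apply Rle_div_r; [lra | rewrite Rmult_0_l; apply nstep_bounds]. }
  assert (hv : 0 <= v).
  { apply Rle_div_r; [lra | rewrite Rmult_0_l; apply nstep_bounds]. }
  assert (hru : 0 <= rho * u) by (apply Rmult_le_pos; lra).
  assert (e1 : rho * u + v =
     (rho + odd_ratio n) * Q i + (rho * even_error i n + odd_error i n)).
  { unfold even_error, odd_error, poly_even, poly_odd. fold u v. field. lra. }
  assert (e2 : (rho - odd_ratio n) * Q' i =
     rho * u - v - (rho * even_error i n - odd_error i n)).
  { unfold even_error, odd_error, poly_even, poly_odd. fold u v. field. lra. }
  split; [| lra].
  rewrite <- Rabs_mult, e2.
  assert (h1 := Rle_abs (even_error i n)). assert (h2 := Rle_abs (- even_error i n)).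
  assert (h3 := Rle_abs (odd_error i n)). assert (h4 := Rle_abs (- odd_error i n)).
  rewrite Rabs_Ropp in h2, h4.
  apply (Rmult_le_compat_l rho) in h1, h2; try lra.
  apply Rabs_le. lra.
Qed.

(** If [Q i < 0], then [rho + odd_ratio n], whose limit is still unknown, can be replaced by its
    lower bound [rho] before passing to the limit. *)
Lemma poly_rho_nonneg i : 0 <= Q i.
Proof.
  destruct (Rle_lt_dec 0 (Q i)) as [| neg]; [assumption |].
  destruct (errors_lim i) as [HX HY].
  assert (H : Rbar_le 0 (rho * Q i + (rho * 0 + 0))).
  { apply (is_lim_seq_le (fun _ => 0)
      (fun n => rho * Q i + (rho * even_error i n + odd_error i n))).
    - intros n. destruct (poly_even_odd_bound i n) as [_ h].
      assert (h' := odd_ratio_bounds n). nra.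
    - apply is_lim_seq_const.
    - lim_arith. }
  simpl in H. nra.
Qed.

(** At a zero [Q (S i)] the recurrence would make a positive multiple of [Q i] plus a nonnegative
    term equal 0. *)
Lemma poly_rho_pos i : 0 < Q i.
Proof.
  induction i as [| i IH]; [simpl; lra |].
  destruct (poly_rho_nonneg (S i)) as [| e]; [assumption | exfalso].
  assert (h := bd_poly_recurrence rho (S i)). cbv beta in h. cbn [pred] in h.
  rewrite <- e in h.
  assert (h1 := Rmult_lt_0_compat _ _ (hq i) IH).
  assert (h2 := Rmult_le_pos _ _ (Rlt_le _ _ (hp (S i))) (poly_rho_nonneg (S (S i)))).
  lra.
Qed.

(** From [rho <= 1 = p k + q k + r k] the recurrence gives [p k * (Q (S k) - Q k) <= q k * (Q k - Q
    (pred k))]. *)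
Lemma poly_rho_decr i : Q (S i) <= Q i.
Proof.
  assert (step : forall k, Q k <= Q (pred k) -> Q (S k) <= Q k).
  { intros k h. assert (e := bd_poly_recurrence rho k). cbv beta in e.
    assert (h1 := hsum k). assert (h2 := q_nonneg k). assert (h3 := poly_rho_pos k).
    apply Rmult_le_reg_l with (p k); [apply hp |].
    assert (h4 : rho * Q k <= 1 * Q k) by (apply Rmult_le_compat_r; lra).
    assert (h5 := Rmult_le_compat_l _ _ _ h2 h).
    rewrite <- h1 in h4. lra. }
  induction i as [| i IH]; apply step; cbn [pred]; [lra | assumption].
Qed.

(** * Casoratian comparison of the polynomials at [rho] and [- rho] *)

(** The alternating sign turns the recurrence at [- rho] into the one at [rho] with [r] replaced by
    [- r]. *)
Definition poly_alt (i : nat) : R := (-1) ^ i * Q' i.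

Lemma poly_alt_recurrence i :
  p i * poly_alt (S i) = (rho + r i) * poly_alt i - q i * poly_alt (pred i).
Proof.
  assert (e := bd_poly_recurrence (- rho) i). cbv beta in e.
  unfold poly_alt.
  transitivity (- (-1) ^ i * (p i * Q' (S i))); [simpl; ring |].
  replace (p i * Q' (S i)) with (- rho * Q' i - q i * Q' (pred i) - r i * Q' i) by lra.
  destruct i as [| i]; cbn [pred]; [rewrite hq0; simpl |]; simpl pow; ring.
Qed.

(** A discrete Wronskian; with the weight [p i * pi i] it changes only through the terms in [r]. *)
Definition casoratian (i : nat) : R :=
  p i * pi i * (poly_alt (S i) * Q i - poly_alt i * Q (S i)).

Local Notation T i := (sum_f_R0 (fun k => r k * pi k) i).

Lemma casoratian_0 : casoratian 0 = 2 * (r 0%nat * pi 0%nat).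
Proof.
  unfold casoratian.
  assert (e := bd_poly_recurrence rho 0%nat). assert (e' := poly_alt_recurrence 0).
  cbv beta in e. rewrite hq0 in e, e'.
  replace (poly_alt 0) with 1 in * by (unfold poly_alt; simpl; ring).
  change (Q 0) with 1 in *. change (pi 0%nat) with 1. lra.
Qed.

Lemma casoratian_S i :
  casoratian (S i) = casoratian i + 2 * (r (S i) * pi (S i)) * (poly_alt (S i) * Q (S i)).
Proof.
  unfold casoratian.
  assert (e := bd_poly_recurrence rho (S i)). assert (e' := poly_alt_recurrence (S i)).
  cbv beta in e. cbn [pred] in e, e'.
  assert (b := pi_balance i).
  transitivity (pi (S i) * ((p (S i) * poly_alt (S (S i))) * Q (S i)
    - poly_alt (S i) * (p (S i) * Q (S (S i))))); [ring |].
  replace (p (S i) * Q (S (S i))) with ((rho - r (S i)) * Q (S i) - q (S i) * Q i) by lra.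
  rewrite e'.
  replace (p i * pi i) with (pi (S i) * q (S i)) by lra.
  ring.
Qed.

Lemma T_nonneg i : 0 <= T i.
Proof.
  apply cond_pos_sum. intros k. apply Rmult_le_pos; [apply hr | left; apply pi_pos].
Qed.

(* The Casoratian is [2 * sum_(k <= i) r k * pi k * poly_alt k * Q k], and
   [poly_alt k * Q k >= Q k ^ 2 >= Q i ^ 2] because [Q] decreases. *)
Lemma casoratian_bound i : Q i <= poly_alt i /\ 2 * T i * Q i ^ 2 <= casoratian i.
Proof.
  induction i as [| i [IH1 IH2]].
  - rewrite casoratian_0. unfold poly_alt. simpl. lra.
  - assert (h0 := poly_rho_pos i). assert (h1 := poly_rho_pos (S i)).
    assert (hd := poly_rho_decr i). assert (hT := T_nonneg i).
    assert (hpp := Rmult_lt_0_compat _ _ (hp i) (pi_pos i)).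
    (* A nonnegative Casoratian means that [poly_alt / Q] does not drop from [i] to [S i], so it
       stays at least 1. *)
    assert (hS : Q (S i) <= poly_alt (S i)).
    { assert (hW : 0 <= casoratian i).
      { eapply Rle_trans; [| exact IH2]. assert (0 <= Q i ^ 2) by nra. nra. }
      unfold casoratian in hW.
      apply Rmult_le_reg_l with (Q i); [assumption |].
      apply Rmult_le_reg_l with (p i * pi i); [assumption |].
      assert (hm : Q i * Q (S i) <= poly_alt i * Q (S i)) by nra.
      apply (Rmult_le_compat_l (p i * pi i)) in hm; lra. }
    split; [assumption |].
    rewrite casoratian_S, tech5.
    assert (hw : 0 <= r (S i) * pi (S i))
      by (apply Rmult_le_pos; [apply hr | left; apply pi_pos]).
    assert (k1 : Q (S i) ^ 2 <= Q i ^ 2) by nra.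
    assert (k2 : Q (S i) ^ 2 <= poly_alt (S i) * Q (S i)) by nra.
    apply (Rmult_le_compat_l (2 * T i)) in k1; [| lra].
    apply (Rmult_le_compat_l (2 * (r (S i) * pi (S i)))) in k2; [| lra].
    lra.
Qed.

(** The increment of [poly_alt / Q] at [i] is [casoratian i / (p i * pi i * Q i * Q (S i))];
    [casoratian_bound] and [Q (S i) <= Q i] bound it below. *)
Lemma poly_alt_growth N :
  2 * sum_f_R0 (fun j => / (p j * pi j) * T j) N <= poly_alt (S N) / Q (S N).
Proof.
  assert (step : forall i,
    poly_alt i / Q i + 2 * (/ (p i * pi i) * T i) <= poly_alt (S i) / Q (S i)).
  { intros i. destruct (casoratian_bound i) as [_ h].
    assert (h0 := poly_rho_pos i). assert (h1 := poly_rho_pos (S i)).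
    assert (hd := poly_rho_decr i). assert (hT := T_nonneg i).
    assert (hpp := Rmult_lt_0_compat _ _ (hp i) (pi_pos i)).
    apply Rmult_le_reg_r with (p i * pi i * Q i * Q (S i)).
    { apply Rmult_lt_0_compat; [apply Rmult_lt_0_compat |]; assumption. }
    transitivity (p i * pi i * (poly_alt i * Q (S i)) + 2 * T i * (Q i * Q (S i))).
    { right. field. assert (hp0 := hp i). assert (hpi := pi_pos i). repeat split; lra. }
    transitivity (p i * pi i * (poly_alt (S i) * Q i)).
    2: { right. field. lra. }
    unfold casoratian in h.
    assert (k : Q i * Q (S i) <= Q i ^ 2) by nra.
    apply (Rmult_le_compat_l (2 * T i)) in k; lra. }
  induction N as [| N IH].
  - assert (h := step 0%nat). cbn [sum_f_R0] in *.
    replace (poly_alt 0 / Q 0) with 1 in h by (unfold poly_alt; simpl; field).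
    lra.
  - rewrite tech5. assert (h := step (S N)). lra.
Qed.

(** * Ratio limits from the divergent series *)

Context (hdiv : forall M : R, exists N : nat,
     M < sum_f_R0 (fun j => / (p j * pi j) * T j) N).

Lemma poly_ratio_unbounded M : exists i, M * Q i <= Rabs (Q' i).
Proof.
  destruct (hdiv (M / 2)) as [N HN].
  exists (S N). assert (h := poly_alt_growth N). assert (h1 := poly_rho_pos (S N)).
  assert (e : Rabs (Q' (S N)) = Rabs (poly_alt (S N))).
  { unfold poly_alt. rewrite Rabs_mult, pow_1_abs. ring. }
  rewrite e. eapply Rle_trans; [| apply Rle_abs].
  apply Rle_div_r; [assumption |]. lra.
Qed.

(** In [poly_even_odd_bound] the right side is bounded by a multiple of [Q i] for large [n], while
    [Rabs (Q' i) / Q i] can be made arbitrarily large by the choice of [i]. *)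
Lemma odd_ratio_lim : is_lim_seq odd_ratio rho.
Proof.
  apply is_lim_seq_spec. intros eps. assert (he := cond_pos eps).
  (* The 4 beats 3: [rho + odd_ratio n] contributes at most 2 and the errors less than 1, in units
     of [Q i]. *)
  destruct (poly_ratio_unbounded (4 / eps)) as [i Hi].
  destruct (errors_lim i) as [HX HY]. assert (hQ := poly_rho_pos i).
  assert (HE : is_lim_seq
    (fun n => 2 * (rho * Rabs (even_error i n) + Rabs (odd_error i n))) 0).
  { apply is_lim_seq_abs_0 in HX. apply is_lim_seq_abs_0 in HY.
    replace (Finite 0) with (Finite (2 * (rho * 0 + 0))) by (f_equal; ring).
    lim_arith. }
  apply is_lim_seq_spec in HE.
  destruct (HE (mkposreal _ hQ)) as [N HN].
  exists N. intros n hn. specialize (HN n hn). simpl in HN.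
  apply Rabs_def2 in HN.
  destruct (poly_even_odd_bound i n) as [h _]. assert (hd := odd_ratio_bounds n).
  rewrite Rabs_minus_sym.
  set (x := Rabs (rho - odd_ratio n)) in *.
  assert (hx : 0 <= x) by apply Rabs_pos.
  apply (Rmult_le_compat_l x) in Hi; [| assumption].
  assert (h3 : (rho + odd_ratio n) * Q i <= 2 * Q i) by (apply Rmult_le_compat_r; lra).
  assert (h4 : x * (4 / eps) < 3).
  { apply Rmult_lt_reg_r with (Q i); [assumption |]. lra. }
  apply Rmult_lt_reg_r with (4 / eps).
  { apply Rdiv_lt_0_compat; lra. }
  replace (eps * (4 / eps)) with 4 by (field; lra). lra.
Qed.

Lemma return_eventually_pos : exists N, forall n, (N <= n)%nat -> 0 < a n.
Proof.
  assert (H := odd_ratio_lim). apply is_lim_seq_spec in H.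
  destruct (H (mkposreal _ rho_pos)) as [N HN]. simpl in HN.
  exists (2 * N)%nat. intros n hn.
  destruct (Nat.Even_or_Odd n) as [[k ->] | [k ->]]; [apply return_even_pos |].
  replace (2 * k + 1)%nat with (S (2 * k)) by lia. rewrite odd_ratio_eq.
  specialize (HN k ltac:(lia)). apply Rabs_def2 in HN.
  apply Rmult_lt_0_compat; [lra | apply return_even_pos].
Qed.

(** Even [n] gives [odd_ratio]; odd [n] gives [even_ratio / odd_ratio], with limit
    [rho ^ 2 / rho]. *)
Lemma return_ratio_lim : is_lim_seq (fun n => a (S n) / a n) rho.
Proof.
  assert (H := odd_ratio_lim).
  assert (H' : is_lim_seq (fun n => even_ratio n / odd_ratio n) rho).
  { replace (Finite rho) with (Finite (rho ^ 2 / rho)) by (f_equal; field; lra).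
    apply is_lim_seq_div'; [assumption | assumption | lra]. }
  apply is_lim_seq_spec in H. apply is_lim_seq_spec in H'.
  apply is_lim_seq_spec. intros eps.
  destruct (H eps) as [N HN]. destruct (H' eps) as [N' HN'].
  destruct return_eventually_pos as [N0 HN0].
  exists (2 * N + 2 * N' + N0)%nat. intros n hn.
  destruct (Nat.Even_or_Odd n) as [[k ->] | [k ->]].
  - apply (HN k). lia.
  - specialize (HN' k ltac:(lia)). specialize (HN0 (2 * k + 1)%nat ltac:(lia)).
    replace (2 * k + 1)%nat with (S (2 * k)) in * by lia.
    replace (S (S (2 * k))) with (2 * S k)%nat by lia.
    replace (a (2 * S k) / a (S (2 * k))) with (even_ratio k / odd_ratio k); [assumption |].
    assert (h := return_even_pos k). unfold even_ratio, odd_ratio. field. lra.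
Qed.

(** The limits inherit the recurrence of [Q], since [F (S n) i / a n] tends to [rho] times the limit
    in row [i]. A general [F] covers both column 0 and column [j]. *)
Lemma column_lim (F : nat -> nat -> R) (c : R) :
  (forall n, bd_recurrence (F (S n)) (F n)) ->
  is_lim_seq (fun n => F n 0%nat / a n) c ->
  forall i, is_lim_seq (fun n => F n i / a n) (c * Q i).
Proof.
  intros HF H0 i.
  cut (is_lim_seq (fun n => F n (pred i) / a n) (c * Q (pred i)) /\
       is_lim_seq (fun n => F n i / a n) (c * Q i)); [tauto |].
  induction i as [| i [IH1 IH2]].
  - cbn [pred bd_poly]. rewrite Rmult_1_r. tauto.
  - split; [assumption |]. assert (h := hp i).
    destruct return_eventually_pos as [N0 HN0].
    apply is_lim_seq_ext_loc with (u := fun n =>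
      / p i * (F (S n) i / a (S n) * (a (S n) / a n)
               - (q i * (F n (pred i) / a n) + r i * (F n i / a n)))).
    { exists N0. intros n hn. assert (h0 := HN0 n hn). assert (h1 := HN0 (S n) ltac:(lia)).
      rewrite (HF n i). field. lra. }
    replace (Finite (c * Q (S i))) with (Finite
      (/ p i * (c * Q i * rho - (q i * (c * Q (pred i)) + r i * (c * Q i))))).
    2: { f_equal. transitivity (c * / p i * (rho * Q i - q i * Q (pred i) - r i * Q i));
      [ring |]. rewrite (bd_poly_recurrence rho i). field. lra. }
    assert (IH2' := proj1 (is_lim_seq_incr_1 _ _) IH2). assert (Hr := return_ratio_lim).
    lim_arith.
Qed.

(** Column 0 is settled first; reversibility turns it into row 0, which is the starting value for
    column [j]. *)
Lemma nstep_return_lim i j :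
  is_lim_seq (fun n => P n i j / a n) (pi j * Q j * Q i).
Proof.
  apply (column_lim (fun n i => P n i j)); [intros n; apply nstep_recurrence |].
  apply is_lim_seq_ext with (u := fun n => pi j * (P n j 0%nat / a n)).
  { intros n. assert (e := nstep_reversible n 0 j). change (pi 0%nat) with 1 in e.
    replace (P n 0%nat j) with (pi j * P n j 0%nat) by lra. unfold Rdiv. ring. }
  apply is_lim_seq_mult'; [apply is_lim_seq_const |].
  replace (Finite (Q j)) with (Finite (1 * Q j)) by (f_equal; ring).
  apply (column_lim (fun n i => P n i 0%nat)); [intros n; apply nstep_recurrence |].
  destruct return_eventually_pos as [N0 HN0].
  apply is_lim_seq_ext_loc with (u := fun _ => 1); [| apply is_lim_seq_const].
  exists N0. intros n hn. specialize (HN0 n hn). field. lra.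
Qed.

Lemma nstep_ratio_lim i j k l :
  is_lim_seq (fun n => P n i j / P n k l) (pi j * Q j * Q i / (pi l * Q l * Q k)).
Proof.
  assert (hne : pi l * Q l * Q k <> 0).
  { assert (h := pi_pos l). assert (h1 := poly_rho_pos l). assert (h2 := poly_rho_pos k).
    apply Rgt_not_eq. apply Rmult_lt_0_compat; [apply Rmult_lt_0_compat |]; assumption. }
  destruct return_eventually_pos as [N0 HN0].
  apply is_lim_seq_ext_loc with (u := fun n => (P n i j / a n) / (P n k l / a n)).
  - exists N0. intros n hn. specialize (HN0 n hn).
    (* These identities hold at 0 too, so only [a n] has to be nonzero, not [P n k l]. *)
    unfold Rdiv. rewrite Rinv_mult, Rinv_inv.
    transitivity (P n i j * / P n k l * (a n * / a n)); [ring |].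
    rewrite Rinv_r by lra. ring.
  - apply is_lim_seq_div'; [apply nstep_return_lim | apply nstep_return_lim | exact hne].
Qed.

End Ratio.

End BirthDeath.

Theorem theorem1 (p q r : nat -> R)
  (hp : forall j, 0 < p j)
  (hq : forall j, 0 < q (S j))
  (hr : forall j, 0 <= r j)
  (hq0 : q O = 0)
  (hsum : forall j, p j + q j + r j = 1)
  (hdiv : forall M : R, exists N : nat,
     M < sum_f_R0 (fun j => / (p j * bd_pi p q j) *
                            sum_f_R0 (fun k => r k * bd_pi p q k) j) N) :
  forall i j k l : nat, exists L : R,
    Un_cv (fun n => bd_nstep p q r n i j / bd_nstep p q r n k l) L.
Proof.
  intros i j k l.
  destruct (even_ratio_lim p q r hp hq hr hq0 hsum) as [rho [[h0 h1] [Hlim Hle]]].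
  eexists. apply is_lim_seq_Reals.
  exact (nstep_ratio_lim p q r hp hq hr hq0 hsum rho h0 h1 Hlim Hle hdiv i j k l).
Qed.
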